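(* For all integers $v\ge4$ and $d\ge1$, \[\sum_{D\in\mathcal{D}_{v,d}(231,312,321)} x^{des(\pi_D)} = (1+x)^{d-1}\left(\sum_{k=0}^{\lfloor\frac{v-2}{2}\rfloor}\binom{v-2-k}{k}x^k\right)^{d}.\]
   Context: A diamond with $v$ vertices ($v\ge4$) is the poset with a least element, a greatest element, and $v-2$ pairwise incomparable middle elements (in a fixed left-to-right order) strictly between them. $\mathcal{D}_{v,d}$ is the set of labellings of $d$ diamonds (placed left to right) by $1,\dots,vd$, each label used once, such that in each diamond least label $<$ each middle label $<$ greatest label. For $D\in\mathcal{D}_{v,d}$, $\pi_D$ is the permutation obtained by reading the diamonds left to right and, within each diamond, the least element, then the middle elements left to right, then the greatest element. $\mathcal{D}_{v,d}(P)$ is the set of $D$ with $\pi_D$ avoiding every classical pattern in $P$. $des(\pi)$ is the number of $i$ with $\pi_i>\pi_{i+1}$. *)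

(* Defs.v *)
From mathcomp Require Import all_boot all_order all_algebra.

Set Implicit Arguments.
Unset Strict Implicit.
Unset Printing Implicit Defensive.

(* Strict order of the diamond on 'I_v: 0 is the least element, v.-1 the
   greatest, and 1, ..., v-2 are the middle elements from left to right. *)
Definition diamond_lt (v : nat) (a b : 'I_v) : bool :=
  ((a == 0 :> nat) && (0 < b)) || ((a < v.-1) && (b == v.-1 :> nat)).

(* D (i, a) is the label of element a of the i-th diamond from the left; the
   label l in {1, ..., v * d} is encoded by the ordinal of value l - 1. *)
Definition labelling (v d : nat) : finType :=
  {ffun 'I_d * 'I_v -> 'I_(v * d)}.

(* Injectivity suffices for "each label is used once": domain and codomain
   have the same cardinality. *)
Definition diamonds (v d : nat) : {set labelling v d} :=
  [set D : labelling v d | injectiveb D &&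
     [forall i : 'I_d, forall a : 'I_v, forall b : 'I_v,
        diamond_lt a b ==> (D (i, a) < D (i, b))]].

Definition reading (v d : nat) (D : labelling v d) : seq nat :=
  [seq (D (i, a)).+1 | i <- enum 'I_d, a <- enum 'I_v].

Definition order_iso (s t : seq nat) : bool :=
  (size s == size t) &&
  [forall i : 'I_(size s), forall j : 'I_(size s),
     (nth 0 s i < nth 0 s j) == (nth 0 t i < nth 0 t j)].

Definition contains_pattern (w p : seq nat) : bool :=
  [exists m : (size w).-tuple bool, order_iso (mask m w) p].

Definition diamonds_avoiding (v d : nat) (P : seq (seq nat)) :
    {set labelling v d} :=
  [set D in diamonds v d |
     all (fun p => ~~ contains_pattern (reading D) p) P].

Definition des (w : seq nat) : nat :=
  #|[set i : 'I_(size w).-1 | nth 0 w i.+1 < nth 0 w i]|.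

(* Main.v *)
Require Import Defs.
From mathcomp Require Import all_boot all_order all_algebra zify ring.

(* A permutation avoids 231, 312 and 321 iff entries at distance at least two
   are in increasing order.  It is then determined by its descent set, which can
   be any set of positions without two consecutive elements.  The diamond
   condition only forbids a descent after the least element and one before the
   greatest element of each diamond.  Hence the v - 3 positions inside a diamond
   contribute a Fibonacci polynomial, and each of the d - 1 boundaries between
   diamonds, isolated by forbidden positions, contributes a free factor 1 + x. *)

(** * Pattern containment in terms of positions *)

Lemma order_isoP (s t : seq nat) :
  reflect (size s = size t /\ forall i j, i < size s -> j < size s ->
             (nth 0 s i < nth 0 s j) = (nth 0 t i < nth 0 t j))
          (order_iso s t).
Proof.
apply: (iffP andP) => [[/eqP sz /forallP H]|[-> H]].
  split=> // i j hi hj.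
  by have /forallP/(_ (Ordinal hj))/eqP := H (Ordinal hi).
by split=> //; apply/forallP=> i; apply/forallP=> j; apply/eqP/H.
Qed.

(** A mask amounts to the increasing list of positions it selects; such lists are easier to exhibit
    and to destruct when the pattern has length three. *)
Lemma contains_patternP (w p : seq nat) :
  reflect (exists2 s, sorted ltn s && all (gtn (size w)) s
                    & order_iso [seq nth 0 w i | i <- s] p)
          (contains_pattern w p).
Proof.
apply: (iffP existsP) => [[m]|[s /andP[s_sorted /allP s_lt] iso]].
  rewrite -{2}(mkseq_nth 0 w) /mkseq -map_mask => iso.
  exists (mask m (iota 0 (size w))) => //; apply/andP; split.
    exact: (subseq_sorted ltn_trans (mask_subseq _ _) (iota_ltn_sorted _ _)).
  by apply/allP=> i /mem_mask; rewrite mem_iota.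
have eq_s : s = [seq i <- iota 0 (size w) | i \in s].
  apply: (irr_sorted_eq ltn_trans ltnn) => //.
    exact/(sorted_filter ltn_trans)/iota_ltn_sorted.
  move=> i; rewrite mem_filter mem_iota add0n /=.
  by case: (boolP (i \in s)) => // /s_lt.
have {}eq_s : s = mask (map (mem s) (iota 0 (size w))) (iota 0 (size w)).
  by rewrite {1}eq_s filter_mask.
have sz : size (map (mem s) (iota 0 (size w))) == size w.
  by rewrite size_map size_iota.
exists (Tuple sz) => /=.
by rewrite -{2}(mkseq_nth 0 w) /mkseq -map_mask -eq_s.
Qed.

Lemma uniq_nth_neq (w : seq nat) (i j : nat) :
  uniq w -> i < j -> j < size w -> nth 0 w i <> nth 0 w j.
Proof.
move=> w_uniq lt_ij lt_j /eqP.
by rewrite nth_uniq // ?(ltn_trans lt_ij) // ltn_eqF.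
Qed.

(* In a triple of distinct entries, the three patterns are exactly those whose
   last entry is smaller than the first. *)
Lemma avoids_231_312_321P (w : seq nat) : uniq w ->
  reflect (forall i k, i.+1 < k -> k < size w -> nth 0 w i < nth 0 w k)
          (all (fun p => ~~ contains_pattern w p)
               [:: [:: 2; 3; 1]; [:: 3; 1; 2]; [:: 3; 2; 1]]).
Proof.
move=> w_uniq; apply: (iffP idP) => [|far].
  move=> /and4P[no231 no312 no321 _] i k lt_ik lt_k.
  rewrite ltnNge; apply/negP=> le_ki.
  have lt_i1 : i.+1 < size w by lia.
  have lt_i : i < size w by lia.
  have ne_ij := uniq_nth_neq w _ _ w_uniq (ltnSn i) lt_i1.
  have ne_ik := uniq_nth_neq w i k w_uniq ltac:(lia) lt_k.
  have ne_jk := uniq_nth_neq w _ _ w_uniq lt_ik lt_k.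
  have contra p : (forall a b, a < 3 -> b < 3 ->
        (nth 0 [:: nth 0 w i; nth 0 w i.+1; nth 0 w k] a
           < nth 0 [:: nth 0 w i; nth 0 w i.+1; nth 0 w k] b)
        = (nth 0 p a < nth 0 p b)) -> size p = 3 -> contains_pattern w p.
    move=> H sz_p; apply/contains_patternP; exists [:: i; i.+1; k].
      by rewrite /= ltnSn lt_ik lt_i lt_i1 lt_k.
    by apply/order_isoP; split=> /=; [rewrite sz_p|exact: H].
  (* The last entry is below the first, so the rank of the middle entry [i.+1] decides the pattern:
     largest gives 231, smallest 312, in between 321. *)
  case: (ltnP (nth 0 w i) (nth 0 w i.+1)) => c1.
    by case/negP: no231; apply: contra => // -[|[|[|a]]] [|[|[|b]]] //= _ _; lia.
  case: (ltnP (nth 0 w i.+1) (nth 0 w k)) => c2.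
    by case/negP: no312; apply: contra => // -[|[|[|a]]] [|[|[|b]]] //= _ _; lia.
  by case/negP: no321; apply: contra => // -[|[|[|a]]] [|[|[|b]]] //= _ _; lia.
have avoid p : size p = 3 -> nth 0 p 2 < nth 0 p 0 -> ~~ contains_pattern w p.
  move=> sz_p lt_p; apply/negP=> /contains_patternP[s].
  case/andP=> s_sorted s_lt /order_isoP[]; rewrite size_map sz_p => sz_s.
  case: s sz_s s_sorted s_lt => [|i [|j [|k []]]] //= _.
  case/and3P=> lt_ij lt_jk _ /and4P[_ _ lt_k _] /(_ 2 0 isT isT) /=.
  by rewrite lt_p => lt_ki; have := far i k ltac:(lia) lt_k; lia.
by rewrite /= !avoid.
Qed.

(** * Permutations recovered from comparisons and descents *)

Lemma rank_perm_iota (n : nat) (w : seq nat) (x : nat) :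
  perm_eq w (iota 1 n) -> x \in w -> count (fun y => y <= x) w = x.
Proof.
move=> w_perm; rewrite (perm_mem w_perm) (permP w_perm) mem_iota => /andP[x0 xn].
have -> : n = x + (n - x) by lia.
rewrite iotaD count_cat.
have /eqP-> : count (fun y => y <= x) (iota 1 x) == size (iota 1 x).
  by rewrite -all_count; apply/allP=> y; rewrite mem_iota; lia.
rewrite size_iota (@eq_in_count _ _ pred0) ?count_pred0 ?addn0 //.
by move=> y; rewrite mem_iota /=; lia.
Qed.

(** Each entry equals its rank, and ranks are computed from comparisons alone. *)
Lemma perm_iota_eq_order (n : nat) (w w' : seq nat) :
  perm_eq w (iota 1 n) -> perm_eq w' (iota 1 n) ->
  (forall i j, i < n -> j < n ->
     (nth 0 w i <= nth 0 w j) = (nth 0 w' i <= nth 0 w' j)) -> w = w'.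
Proof.
move=> pw pw' H.
have sz : size w = n by rewrite (perm_size pw) size_iota.
have sz' : size w' = n by rewrite (perm_size pw') size_iota.
have rank u i : perm_eq u (iota 1 n) -> i < n ->
    nth 0 u i = count (fun j => nth 0 u j <= nth 0 u i) (iota 0 n).
  move=> pu lt_i; have sz_u : size u = n by rewrite (perm_size pu) size_iota.
  rewrite -[LHS](rank_perm_iota n u _ pu) ?mem_nth ?sz_u //.
  rewrite -[X in count _ X](mkseq_nth 0 u) /mkseq count_map sz_u.
  exact: eq_count.
apply: (@eq_from_nth _ 0) => [|i]; rewrite sz // => lt_i.
rewrite (rank w) // (rank w') //; apply: eq_in_count => j.
by rewrite mem_iota /= => lt_j; apply: H.
Qed.

Definition descents (w : seq nat) : bitseq :=
  mkseq (fun i => nth 0 w i.+1 < nth 0 w i) (size w).-1.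

Lemma des_descents (w : seq nat) : des w = count id (descents w).
Proof.
rewrite /des cardsE cardE size_filter /descents /mkseq count_map.
by rewrite -val_enum_ord count_map enumT.
Qed.

Lemma nth_descents (w : seq nat) (i : nat) : i.+1 < size w ->
  nth false (descents w) i = (nth 0 w i.+1 < nth 0 w i).
Proof. by move=> lt_i; rewrite nth_mkseq //; lia. Qed.

(** Comparisons at distance at least two are forced and those at distance one are recorded by the
    descents, so all comparisons agree. This gives the injectivity of the descent word. *)
Lemma eq_descents (n : nat) (w w' : seq nat) :
  perm_eq w (iota 1 n) -> perm_eq w' (iota 1 n) ->
  (forall i k, i.+1 < k -> k < n -> nth 0 w i < nth 0 w k) ->
  (forall i k, i.+1 < k -> k < n -> nth 0 w' i < nth 0 w' k) ->
  descents w = descents w' -> w = w'.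
Proof.
move=> pw pw' far far' eq_des; apply: (perm_iota_eq_order n) => //.
have sz : size w = n by rewrite (perm_size pw) size_iota.
have sz' : size w' = n by rewrite (perm_size pw') size_iota.
have uw : uniq w by rewrite (perm_uniq pw) iota_uniq.
have uw' : uniq w' by rewrite (perm_uniq pw') iota_uniq.
have adj i : i.+1 < n ->
    (nth 0 w i.+1 < nth 0 w i) = (nth 0 w' i.+1 < nth 0 w' i).
  by move=> lt_i; rewrite -!nth_descents ?eq_des // ?sz ?sz'.
have lt_case i j : i < j -> j < n ->
    (nth 0 w j < nth 0 w i) = (nth 0 w' j < nth 0 w' i).
  move=> lt_ij lt_j; have [->|lt_i1] : j = i.+1 \/ i.+1 < j by lia.
    by apply: adj; lia.
  by have := far i j lt_i1 lt_j; have := far' i j lt_i1 lt_j; lia.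
move=> i j lt_i lt_j.
case: (ltngtP i j) => [lt_ij|lt_ji|->]; last by rewrite !leqnn.
  by rewrite !(leqNgt (nth _ _ i)) lt_case.
have := uniq_nth_neq w j i uw lt_ji ltac:(by rewrite sz).
have := uniq_nth_neq w' j i uw' lt_ji ltac:(by rewrite sz').
by have := lt_case j i lt_ji lt_i; lia.
Qed.

(** * Bit words without two consecutive set bits *)

(* The bit words below [A] with no two consecutive bits set; [c] is the bit that
   precedes the word. *)
Fixpoint sparse_words (c : bool) (A : bitseq) : seq bitseq :=
  if A is a :: A' then
    map (cons false) (sparse_words false A') ++
    (if a && ~~ c then map (cons true) (sparse_words true A') else [::])
  else [:: [::]].

Lemma mem_map_cons (a : bool) (b : bitseq) (s : seq bitseq) :
  (b \in map (cons a) s) = (if b is x :: b' then (x == a) && (b' \in s) else false).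
Proof.
apply/mapP/idP => [[b' b'_in ->]|]; first by rewrite eqxx.
by case: b => // x b' /andP[/eqP-> b'_in]; exists b'.
Qed.

Lemma mem_sparse_words (c : bool) (A b : bitseq) :
  (b \in sparse_words c A) =
  path (fun x y => ~~ (x && y)) c b && all2 implb b A.
Proof.
elim: A c b => [|a A IH] c [|x b] //=; first by rewrite andbF.
  by rewrite mem_cat mem_map_cons; case: ifP; rewrite ?mem_map_cons ?andbF.
rewrite mem_cat mem_map_cons IH.
by case: x; case: c; case: a; rewrite //= ?mem_map_cons ?IH ?andbF ?orbF.
Qed.

Lemma sparse_words_uniq (c : bool) (A : bitseq) : uniq (sparse_words c A).
Proof.
elim: A c => //= a A IH c.
have cons_inj x : injective (cons x : bitseq -> bitseq) by move=> ? ? [].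
rewrite cat_uniq map_inj_uniq //= IH /=.
case: ifP => // _; rewrite map_inj_uniq // IH andbT.
apply/hasPn=> b; rewrite !mem_map_cons.
by case: b => // x b /andP[/eqP-> _].
Qed.

Lemma all2_implbP (b A : bitseq) :
  reflect (size b = size A /\ forall i, nth false b i -> nth false A i)
          (all2 implb b A).
Proof.
elim: b A => [|x b IH] [|a A] /=; try by constructor; case.
  by constructor; split.
apply: (iffP andP) => [[xa /IH[sz H]]|[[sz] H]].
  by split; [rewrite sz|case=> //=; apply/implyP].
by split; [apply/implyP/(H 0)|apply/IH; split=> // i; apply: (H i.+1)].
Qed.

(** The default [false] clears all bits past the end, so the conditions can range over every [i]. *)
Lemma sparse_wordsP (A b : bitseq) :
  reflect [/\ size b = size A, forall i, nth false b i -> nth false A i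
            & forall i, ~~ (nth false b i && nth false b i.+1)]
          (b \in sparse_words false A).
Proof.
rewrite mem_sparse_words; apply: (iffP andP).
  move=> [/(pathP false) Hp /all2_implbP[sz H]]; split=> // i.
  case: (ltnP i.+1 (size b)) => [lt_i|ge_i]; first exact: (Hp i.+1).
  by rewrite (nth_default _ ge_i) andbF.
move=> [sz H sp]; split; last exact/all2_implbP.
by apply/(pathP false) => -[|i] // _; apply: sp.
Qed.

(** * Generating polynomials of sparse words *)

Import GRing.Theory.
Local Open Scope ring_scope.

Definition sparse_gf (c : bool) (A : bitseq) : {poly int} :=
  \sum_(b <- sparse_words c A) 'X^(count id b).

Lemma sparse_gf_nil (c : bool) : sparse_gf c [::] = 1.
Proof. by rewrite /sparse_gf big_seq1. Qed.

Lemma sparse_gf_cons (c a : bool) (A : bitseq) :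
  sparse_gf c (a :: A) =
  sparse_gf false A + (if a && ~~ c then 'X * sparse_gf true A else 0).
Proof.
rewrite /sparse_gf /= big_cat big_map /=; congr (_ + _).
case: ifP => _; last by rewrite big_nil.
by rewrite big_map mulr_sumr; apply: eq_bigr => b _; rewrite /= exprS.
Qed.

(** A forbidden position forces a clear bit, which makes the choices on its two sides
    independent. *)
Lemma sparse_gf_cat_false (c : bool) (A B : bitseq) :
  sparse_gf c (A ++ false :: B) = sparse_gf c A * sparse_gf false B.
Proof.
elim: A c => [|a A IH] c /=.
  by rewrite sparse_gf_cons sparse_gf_nil mul1r addr0.
by rewrite !sparse_gf_cons !IH; case: ifP => _; rewrite ?addr0 // mulrDl mulrA.
Qed.

(** This is the Fibonacci recurrence for diagonal sums of Pascal's triangle. The terms at [k = 0]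
    match, the last term on the left is zero, and Pascal's rule splits the others. *)
Lemma sum_bin_diag_rec (m : nat) :
  \sum_(0 <= k < m.+3) ('X^k *+ 'C(m.+2 - k, k) : {poly int}) =
  \sum_(0 <= k < m.+2) 'X^k *+ 'C(m.+1 - k, k) +
  'X * \sum_(0 <= k < m.+1) 'X^k *+ 'C(m - k, k).
Proof.
rewrite big_nat_recl // big_nat_recr //= subnn bin0n mulr0n addr0.
rewrite [in RHS]big_nat_recl // mulr_sumr -addrA; congr (_ + _).
rewrite -big_split /=; apply: eq_big_nat => k /andP[_ lt_k].
have -> : (m.+2 - k.+1 = (m - k).+1)%N by lia.
by rewrite binS mulrnDr subSS mulrnAr -exprS.
Qed.

Lemma sparse_gf_nseq (k : nat) :
  sparse_gf false (nseq k true) =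
  \sum_(0 <= j < k.+2) 'X^j *+ 'C(k.+1 - j, j).
Proof.
(* The recurrence has order two, so the induction carries two consecutive lengths. *)
have [] //: sparse_gf false (nseq k true) =
    \sum_(0 <= j < k.+2) 'X^j *+ 'C(k.+1 - j, j) /\
  sparse_gf false (nseq k.+1 true) =
    \sum_(0 <= j < k.+3) 'X^j *+ 'C(k.+2 - j, j).
elim: k => [|k [IH1 IH2]].
  rewrite !big_nat_recl // !big_geq //= sparse_gf_cons !sparse_gf_nil.
  by rewrite /= !mulr0n !addr0 mulr1.
split=> //; rewrite sum_bin_diag_rec -IH2 -IH1 [in LHS]/= sparse_gf_cons /=.
(* After a set bit the next one must be clear, which leaves [k] free positions. *)
by rewrite [sparse_gf true _]sparse_gf_cons andbF addr0.
Qed.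

(** Beyond [m %/ 2] one has [m - k < k], so the binomial coefficient vanishes. *)
Lemma sum_bin_diag_half (m : nat) :
  \sum_(0 <= k < m.+1) ('X^k *+ 'C(m - k, k) : {poly int}) =
  \sum_(0 <= k < (m %/ 2).+1) 'X^k *+ 'C(m - k, k).
Proof.
rewrite (big_cat_nat (n := (m %/ 2).+1)) //=; last by lia.
rewrite [X in _ + X]big1_seq ?addr0 // => k /andP[_].
by rewrite mem_index_iota => lt_k; rewrite bin_small //; lia.
Qed.

Local Close Scope ring_scope.

(** * Descent positions allowed by the diamonds *)

(** Positions count from 0. Residue [0] is the step out of a least element, residue [v - 2] the step
    into a greatest element, and residue [v.-1] the boundary between two diamonds. *)
Definition allowed_descents (v n : nat) : bitseq :=
  mkseq (fun p => (p %% v != 0) && (p %% v != v - 2)) n.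

(** The first [v.-1] positions are the steps inside one diamond. The case [m = 0] serves the last
    diamond, positive [m] the others. *)
Lemma allowed_descents_addl (v m : nat) : 4 <= v ->
  allowed_descents v (v.-1 + m) =
  false :: nseq (v - 3) true ++
  false :: mkseq (fun p => ((p + v.-1) %% v != 0) && ((p + v.-1) %% v != v - 2)) m.
Proof.
move=> hv; rewrite /allowed_descents.
have -> : v.-1 + m = (1 + (v - 3)) + m.+1 by lia.
rewrite /mkseq !iotaD !map_cat /= mod0n; congr (_ :: _ ++ _).
  apply: (@eq_from_nth _ false) => [|i].
    by rewrite size_map size_iota size_nseq.
  rewrite size_map size_iota => lt_i.
  rewrite (nth_map 0) ?size_iota // nth_iota // nth_nseq lt_i.
  by rewrite modn_small; lia.
have -> : 1 + (v - 3) = v - 2 by lia.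
rewrite modn_small ?eqxx ?andbF; last by lia.
congr (_ :: _); rewrite -[(v - 2).+1]addn0 iotaDl -map_comp.
by apply: eq_map => p /=; have -> : (v - 2).+1 + p = p + v.-1 by lia.
Qed.

(** Peels off the first diamond and the boundary after it, the isolated [true]; the residues then
    start again at [0]. *)
Lemma allowed_descents_block (v d : nat) : 4 <= v ->
  allowed_descents v (v * d.+2).-1 =
  false :: nseq (v - 3) true ++
  false :: true :: allowed_descents v (v * d.+1).-1.
Proof.
move=> hv; have -> : (v * d.+2).-1 = v.-1 + (v * d.+1).-1.+1 by nia.
rewrite allowed_descents_addl //; congr (_ :: _ ++ _ :: _).
rewrite /mkseq /= add0n modn_small; last by lia.
have -> : (v.-1 != 0) && (v.-1 != v - 2) by lia.
congr (_ :: _); rewrite -[1]addn0 iotaDl -map_comp.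
apply: eq_map => p /=; have -> : 1 + p + v.-1 = p + v by lia.
by rewrite modnDr.
Qed.

(** The word is empty or starts with a forbidden position, which absorbs the constraint from the
    preceding bit. Hence both choices at a boundary leave the same factor, whence [1 + 'X]. *)
Lemma sparse_gf_allowed_start (v n : nat) (c : bool) :
  sparse_gf c (allowed_descents v n) = sparse_gf false (allowed_descents v n).
Proof.
case: n => [|n]; first by rewrite !sparse_gf_nil.
by rewrite /allowed_descents /mkseq /= mod0n !sparse_gf_cons.
Qed.

Lemma sparse_gf_allowed (v d : nat) : 4 <= v ->
  sparse_gf false (allowed_descents v (v * d.+1).-1) =
  ((1 + 'X) ^+ d * sparse_gf false (nseq (v - 3) true) ^+ d.+1)%R.
Proof.
move=> hv; elim: d => [|d IH].
  rewrite muln1 -[v.-1]addn0 allowed_descents_addl // sparse_gf_cons addr0.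
  by rewrite sparse_gf_cat_false sparse_gf_nil mulr1 expr0 mul1r expr1.
rewrite allowed_descents_block // sparse_gf_cons addr0 sparse_gf_cat_false.
rewrite sparse_gf_cons /= sparse_gf_allowed_start IH !exprS.
by ring.
Qed.

(** * The reading word and its positions *)

Lemma nth_allpairs (S T R : Type) (f : S -> T -> R) (s : seq S) (t : seq T)
    (x0 : S) (y0 : T) (z0 : R) (i j : nat) : i < size s -> j < size t ->
  nth z0 [seq f x y | x <- s, y <- t] (i * size t + j) =
  f (nth x0 s i) (nth y0 t j).
Proof.
elim: s i => [|x s IH] [|i] //= lt_i lt_j; rewrite nth_cat size_map.
  by rewrite add0n lt_j (nth_map y0).
rewrite mulSn -addnA ltnNge leq_addr /= addKn; exact: IH.
Qed.

Lemma size_reading (v d : nat) (D : labelling v d) : size (reading D) = v * d.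
Proof. by rewrite size_allpairs -!cardE !card_ord mulnC. Qed.

Lemma nth_reading (v d : nat) (D : labelling v d) (i : 'I_d) (a : 'I_v) :
  nth 0 (reading D) (i * v + a) = (D (i, a)).+1.
Proof.
have sz : size (enum 'I_v) = v by rewrite -cardE card_ord.
rewrite -{2}sz (nth_allpairs _ _ _ _ _ _ i a) ?sz -?cardE ?card_ord //.
by rewrite !nth_ord_enum.
Qed.

Lemma position_lt (v d : nat) (i : 'I_d) (a : 'I_v) : i * v + a < v * d.
Proof. by case: i a => i lt_i [a lt_a] /=; nia. Qed.

Lemma positionP (v d p : nat) : p < v * d ->
  exists i : 'I_d, exists a : 'I_v, p = i * v + a.
Proof.
move=> lt_p; have v0 : 0 < v by case: v lt_p.
have lt_i : p %/ v < d by rewrite ltn_divLR // mulnC.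
by exists (Ordinal lt_i), (Ordinal (ltn_pmod p v0)); rewrite /= -divn_eq.
Qed.

Lemma reading_inj (v d : nat) : injective (@reading v d).
Proof.
move=> D D' eqr; apply/ffunP=> -[i a]; apply/val_inj/succn_inj => /=.
by rewrite -!nth_reading eqr.
Qed.

Lemma reading_uniqP (v d : nat) (D : labelling v d) :
  reflect (injective D) (uniq (reading D)).
Proof.
apply: (iffP idP) => [ur [i a] [j b] eqD|D_inj].
  have : nth 0 (reading D) (i * v + a) == nth 0 (reading D) (j * v + b).
    by rewrite !nth_reading eqD.
  rewrite nth_uniq ?size_reading ?position_lt // => /eqP eq_p.
  have v0 : 0 < v by exact: leq_ltn_trans (leq0n a) (ltn_ord a).
  have eq_ij : i = j.
    apply/val_inj; have := congr1 (divn^~ v) eq_p.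
    by rewrite /= !divnMDl // !divn_small // !addn0.
  have eq_ab : a = b by apply/val_inj; move: eq_p; rewrite eq_ij => /addnI.
  by rewrite eq_ij eq_ab.
apply: allpairs_uniq; rewrite ?enum_uniq // => -[i a] [j b] _ _ /= [] eqD.
exact/D_inj/val_inj.
Qed.

(** By counting: [v * d] distinct entries, all between [1] and [v * d]. *)
Lemma reading_perm_iota (v d : nat) (D : labelling v d) :
  uniq (reading D) -> perm_eq (reading D) (iota 1 (v * d)).
Proof.
move=> ur; apply: uniq_perm; rewrite ?iota_uniq //.
apply: (uniq_min_size ur _ _).2; last by rewrite size_iota size_reading.
by move=> x /allpairsP[[i a] [_ _ ->]]; rewrite mem_iota /= add1n ltnS.
Qed.

(** Elements of a diamond that are comparable and adjacent in the reading occur only at offsets [0]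
    and [v - 2]; all other diamond inequalities follow from the condition at distance at least
    two. *)
Lemma diamonds_avoidingP (v d : nat) (D : labelling v d) : 4 <= v ->
  reflect
    [/\ uniq (reading D),
        forall i k, i.+1 < k -> k < v * d ->
          nth 0 (reading D) i < nth 0 (reading D) k &
        forall p, p.+1 < v * d ->
          nth 0 (reading D) p.+1 < nth 0 (reading D) p ->
          (p %% v != 0) && (p %% v != v - 2)]
    (D \in diamonds_avoiding v d [:: [:: 2; 3; 1]; [:: 3; 1; 2]; [:: 3; 2; 1]]).
Proof.
move=> hv; rewrite !inE -andbA; apply: (iffP and3P).
  move=> [/injectiveP/reading_uniqP ur /forallP incr].
  move=> /(avoids_231_312_321P _ ur); rewrite size_reading => far.
  split=> // p lt_p desc.
  have [i [a def_p]] := positionP v d p ltac:(lia).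
  have mod_p : p %% v = a by rewrite def_p modnMDl modn_small.
  have no_desc (hb : a.+1 < v) : ~~ diamond_lt a (Ordinal hb).
    apply/negP=> lt_ab; have /forallP/(_ a)/forallP/(_ (Ordinal hb)) := incr i.
    rewrite lt_ab /= -ltnS -!nth_reading /= addnS -def_p.
    by rewrite ltnNge ltnW.
  have lt_a := ltn_ord a.
  rewrite mod_p -negb_or; apply/negP=> bad_a.
  have hb : a.+1 < v by lia.
  by have := no_desc hb; rewrite /diamond_lt /=; lia.
move=> [ur far adj]; split; first exact/injectiveP/reading_uniqP.
  apply/forallP=> i; apply/forallP=> a; apply/forallP=> b; apply/implyP=> lt_ab.
  rewrite -ltnS -!nth_reading.
  have lt_a := ltn_ord a; have lt_b := ltn_ord b.
  have lt_p := position_lt v d i b.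
  have [ltab [lt1|[eq_b bad_a]]] :
      a < b /\ (a.+1 < b \/ (b = a.+1 :> nat /\ (a = 0 :> nat \/ a = v - 2 :> nat))).
    by move: lt_ab; rewrite /diamond_lt; lia.
  - by apply: far => //; lia.
  rewrite eq_b addnS in lt_p *; rewrite ltnNge; apply/negP=> le_ba.
  have ne := uniq_nth_neq (reading D) _ _ ur (ltnSn (i * v + a)).
  rewrite size_reading in ne.
  have := adj _ lt_p; rewrite ltn_neqAle le_ba andbT.
  move=> /(_ ltac:(by apply/eqP => /esym; apply: ne)).
  by rewrite modnMDl modn_small; lia.
by apply/avoids_231_312_321P; rewrite ?size_reading.
Qed.

(** * A permutation with prescribed sparse descents *)

(* The permutation of the naturals that swaps [i] and [i.+1] for every [i] whose
   bit is set; this is a product of disjoint transpositions when no two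
   consecutive bits are set. *)
Definition swaps (b : bitseq) (i : nat) : nat :=
  if nth false b i then i.+1
  else if (0 < i) && nth false b i.-1 then i.-1 else i.

Lemma swaps_bound (b : bitseq) (n i : nat) :
  size b = n.-1 -> i < n -> swaps b i < n.
Proof.
move=> sz lt_i; rewrite /swaps; case: ifP => [bi|_]; last by case: ifP; lia.
have : i < size b by rewrite ltnNge; apply/negP=> /(nth_default false); rewrite bi.
by lia.
Qed.

(** Every argument moves by at most one, so only [k = i.+2] is at risk; a collision at [i.+1] would
    need bits [i] and [i.+1] both set. *)
Lemma swaps_far (b : bitseq) (i k : nat) :
  (forall i, ~~ (nth false b i && nth false b i.+1)) ->
  i.+1 < k -> swaps b i < swaps b k.
Proof.
move=> sparse lt_ik; have := sparse i; rewrite /swaps.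
have [->|gt_k] : k = i.+2 \/ i.+2 < k by lia.
  by rewrite /=; do ![case: ifP => //=]; lia.
by do ![case: ifP => //=]; lia.
Qed.

(** A set bit exchanges [i] and [i.+1]; at a clear bit, [i] does not move up and [i.+1] does not
    move down. *)
Lemma swaps_descent (b : bitseq) (i : nat) :
  (forall i, ~~ (nth false b i && nth false b i.+1)) ->
  (swaps b i.+1 < swaps b i) = nth false b i.
Proof.
move=> sparse; have := sparse i; rewrite /swaps /=.
by case: (nth false b i) => /=; do ![case: ifP => //=]; lia.
Qed.

Lemma swaps_inj (b : bitseq) :
  (forall i, ~~ (nth false b i && nth false b i.+1)) -> injective (swaps b).
Proof.
move=> sparse.
have ne i k : i < k -> swaps b i <> swaps b k.
  move=> lt_ik; have [->|lt1] : k = i.+1 \/ i.+1 < k by lia.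
    have := sparse i; rewrite /swaps /=.
    by case: (nth false b i) => /=; do ![case: ifP => //=]; lia.
  by have := swaps_far b i k sparse lt1; lia.
by move=> i k eq_ik; case: (ltngtP i k) => // /ne; rewrite eq_ik.
Qed.

(** * The bijection between labellings and sparse words *)

(** Two consecutive descents would put entry [i.+2] below entry [i], against the condition at
    distance two. *)
Lemma descents_sparse (v d : nat) (D : labelling v d) : 4 <= v ->
  D \in diamonds_avoiding v d [:: [:: 2; 3; 1]; [:: 3; 1; 2]; [:: 3; 2; 1]] ->
  descents (reading D) \in sparse_words false (allowed_descents v (v * d).-1).
Proof.
move=> hv /diamonds_avoidingP[] // ur far adj.
have sz : size (descents (reading D)) = (v * d).-1.
  by rewrite size_mkseq size_reading.
have bit_lt i : nth false (descents (reading D)) i -> i.+1 < v * d.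
  move=> bi; have : i < size (descents (reading D)).
    by rewrite ltnNge; apply/negP=> /(nth_default false); rewrite bi.
  by rewrite sz; lia.
apply/sparse_wordsP; split; first by rewrite sz size_mkseq.
  move=> i bi; have lt_i := bit_lt i bi.
  rewrite nth_mkseq; last by lia.
  by apply: adj => //; rewrite -nth_descents ?size_reading.
move=> i; apply/negP=> /andP[bi bi1].
have lt_i1 := bit_lt _ bi1.
move: bi bi1; rewrite !nth_descents ?size_reading //; last by lia.
by have := far i i.+2 (ltnSn _) lt_i1; lia.
Qed.

Lemma descents_surj (v d : nat) (b : bitseq) : 4 <= v ->
  b \in sparse_words false (allowed_descents v (v * d).-1) ->
  exists2 D, D \in diamonds_avoiding v d
                     [:: [:: 2; 3; 1]; [:: 3; 1; 2]; [:: 3; 2; 1]]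
           & descents (reading D) = b.
Proof.
move=> hv /sparse_wordsP[]; rewrite size_mkseq => sz b_allowed sparse.
have lab_lt (x : 'I_d * 'I_v) : swaps b (x.1 * v + x.2) < v * d.
  by apply: swaps_bound => //; apply: position_lt.
(* Labels are stored minus one, so the values of [swaps b], which start at 0, are used directly. *)
pose D : labelling v d := [ffun x => Ordinal (lab_lt x)].
have nthD p : p < v * d -> nth 0 (reading D) p = (swaps b p).+1.
  by move=> /positionP[i [a ->]]; rewrite nth_reading ffunE.
exists D.
  apply/diamonds_avoidingP => //; split.
  - apply/(uniqP 0) => i j; rewrite !inE size_reading => lt_i lt_j.
    by rewrite !nthD // => -[/(swaps_inj b sparse)].
  - by move=> i k lt_ik lt_k; rewrite !nthD //; [exact: swaps_far|lia].
  move=> p lt_p; rewrite !nthD //; last by lia.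
  rewrite ltnS swaps_descent // => /b_allowed.
  by rewrite nth_mkseq //; lia.
apply: (@eq_from_nth _ false) => [|i]; rewrite size_mkseq size_reading // => lt_i.
rewrite nth_descents ?size_reading; last by lia.
by rewrite !nthD ?ltnS ?swaps_descent //; lia.
Qed.

Local Open Scope ring_scope.

Theorem theorem4p5 (v d : nat) (hv : (4 <= v)%N) (hd : (1 <= d)%N) :
  \sum_(D in diamonds_avoiding v d [:: [:: 2; 3; 1]; [:: 3; 1; 2]; [:: 3; 2; 1]]%N)
     'X^(des (reading D))
  = (1 + 'X) ^+ (d - 1)
    * (\sum_(0 <= k < ((v - 2) %/ 2).+1) 'X^k *+ 'C(v - 2 - k, k)) ^+ d
  :> {poly int}.
Proof.
set S := diamonds_avoiding _ _ _.
transitivity (sparse_gf false (allowed_descents v (v * d).-1)).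
  rewrite -big_enum /=; under eq_bigr do rewrite des_descents.
  rewrite -(big_map (fun D => descents (reading D)) xpredT
              (fun b => 'X^(count id b))).
  (* The descent words of the labellings list the sparse words, each exactly once: same members, no
     repetition on either side. *)
  apply: perm_big; apply: uniq_perm; last 1 first.
  - move=> b; apply/mapP/idP => [[D]|/(descents_surj v d b hv)[D DS <-]].
      by rewrite mem_enum => DS ->; apply: descents_sparse.
    by exists D; rewrite ?mem_enum.
  - rewrite map_inj_in_uniq ?enum_uniq // => D D'; rewrite !mem_enum.
    move=> /diamonds_avoidingP[] // ur far _ /diamonds_avoidingP[] // ur' far' _.
    move=> eq_des; apply: reading_inj.
    by apply: (eq_descents (v * d)) => //; apply: reading_perm_iota.
  exact: sparse_words_uniq.
case: d hd {S} => // d _; rewrite sparse_gf_allowed // subn1 /=.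
(* A run of [v - 3] free positions gives the diagonal sum of index [v - 2]. *)
congr (_ * _ ^+ _); rewrite sparse_gf_nseq -sum_bin_diag_half.
by have -> : (v - 3).+1 = (v - 2)%N by lia.
Qed.
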